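(* Let $X$ be a set, let $\Omega$ be an algebra of subsets of $X$, let $E$ be a $\sigma$-monotone complete partially ordered vector space, let $\mu:\Omega\to\overline{E^+}$ be an $\overline{E^+}$-valued measure, and let $(\Delta_n)_{n=1}^\infty$ be a sequence in $\Omega$. Suppose that $\Gamma_k:=\bigcup_{n=k}^\infty\Delta_n\in\Omega$ for all $k\ge1$, and that $\Gamma:=\bigcap_{k=1}^\infty\Gamma_k=\bigcap_{k=1}^\infty\bigcup_{n=k}^\infty\Delta_n\in\Omega$. (1) If $\bigvee_{N=1}^\infty\sum_{n=1}^N\mu(\Delta_n)\in E$, then $\mu(\Gamma)=0$. (2) If $\mu\big(\big(\bigcup_{n=1}^\infty\Delta_n\big)\setminus\Gamma\big)\in E$, then $\mu(\Gamma)\ge x$ in $\overline E$ for all $x\in E$ with the property that $\mu(\Delta_n)\ge x$ for all $n\ge1$.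
   Context: All vector spaces are real. A partially ordered vector space $E$ has a proper positive cone $E^+$ (i.e. $E^+\cap(-E^+)=\{0\}$), not required to be generating. $E$ is $\sigma$-monotone complete if every increasing sequence in $E$ that is bounded from above has a supremum in $E$. Extended space: $\overline{E}=E\cup\{\infty\}$ (disjoint union), ordered by extending the order of $E$ with $x\le\infty$ for all $x\in\overline E$; $\infty+x=x+\infty=\infty$ for all $x\in\overline E$. $\overline{E^+}=E^+\cup\{\infty\}$. If $E$ is $\sigma$-monotone complete, every increasing sequence in $\overline E$ has a supremum in $\overline E$; the supremum in (1) is taken in $\overline E$. An algebra of subsets of $X$ is a non-empty collection of subsets closed under complements and finite unions. An $\overline{E^+}$-valued measure on $\Omega$ is a map $\mu:\Omega\to\overline{E^+}$ with $\mu(\emptyset)=0$ and $\mu\big(\bigcup_{n=1}^\infty A_n\big)=\bigvee_{N=1}^\infty\sum_{n=1}^N\mu(A_n)$ in $\overline E$ for every pairwise disjoint sequence $(A_n)$ in $\Omega$ with $\bigcup_{n=1}^\infty A_n\in\Omega$. *)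

(* Defs.v *)
From HB Require Import structures.
From mathcomp Require Import all_boot all_order all_algebra.
From mathcomp Require Import all_classical all_reals all_analysis.

Set Implicit Arguments.
Unset Strict Implicit.
Unset Printing Implicit Defensive.

Import Order.TTheory GRing.Theory Num.Theory.

Local Open Scope classical_set_scope.
Local Open Scope ring_scope.

(* The positive cone is [set x | 0 <= x].  It is proper because <= is
   antisymmetric; it need not be generating. *)
HB.mixin Record isOrderedVector (R : numDomainType) E
    of Num.POrderedZmodule E & GRing.Lmodule R E := {
  lev_add2r : forall z x y : E, x <= y -> x + z <= y + z ;
  scalev_ge0 : forall (a : R) (x : E), 0 <= a -> 0 <= x -> 0 <= a *: x
}.

#[short(type="orderedVectType")]
HB.structure Definition OrderedVector (R : numDomainType) :=
  { E of isOrderedVector R E & Num.POrderedZmodule E & GRing.Lmodule R E }.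

Definition sigma_monotone_complete d (T : porderType d) : Prop :=
  forall u : nat -> T, nondecreasing_seq u -> has_ubound (range u) ->
    exists s : T, isLub (range u) s.

Inductive extended_space (E : Type) := ext_fin of E | ext_infty.
Arguments ext_infty {E}.

Notation ext := extended_space.

Section ext_choice.
Variable E : choiceType.

Definition option_of_ext (x : ext E) : option E :=
  if x is ext_fin r then Some r else None.
Definition ext_of_option (x : option E) : ext E :=
  if x is Some r then ext_fin r else ext_infty.

Lemma option_of_extK : cancel option_of_ext ext_of_option.
Proof. by case. Qed.

HB.instance Definition _ :=
  Choice.copy (ext E) (can_type option_of_extK).

End ext_choice.

Section ext_order.
Variable E : porderZmodType.

Definition le_ext (x y : ext E) : bool :=
  match x, y with
  | _, ext_infty => true
  | ext_fin r, ext_fin s => r <= s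
  | ext_infty, ext_fin _ => false
  end.

Lemma le_ext_refl : reflexive le_ext.
Proof. by case=> /=. Qed.

Lemma le_ext_anti : antisymmetric le_ext.
Proof. by move=> [x|] [y|] //= /le_anti ->. Qed.

Lemma le_ext_trans : transitive le_ext.
Proof. by move=> [y|] [x|] [z|] //=; exact: le_trans. Qed.

HB.instance Definition _ := Order.Le_isPOrder.Build ring_display (ext E)
  le_ext_refl le_ext_anti le_ext_trans.

End ext_order.

Section ext_nmodule.
Variable E : zmodType.

Definition add_ext (x y : ext E) : ext E :=
  match x, y with
  | ext_fin r, ext_fin s => ext_fin (r + s)
  | _, _ => ext_infty
  end.

Lemma add_extA : associative add_ext.
Proof. by move=> [x|] [y|] [z|] //=; rewrite addrA. Qed.

Lemma add_extC : commutative add_ext.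
Proof. by move=> [x|] [y|] //=; rewrite addrC. Qed.

Lemma add_ext0 : left_id (ext_fin 0) add_ext.
Proof. by move=> [x|] //=; rewrite add0r. Qed.

HB.instance Definition _ := GRing.isNmodule.Build (ext E)
  add_extA add_extC add_ext0.

End ext_nmodule.

Definition set_algebra (X : Type) (Omega : set (set X)) : Prop :=
  [/\ Omega !=set0, setC_closed Omega & setU_closed Omega].

(* [mu] is a total function, but only its values on [Omega] are constrained. *)
Definition ext_measure (X : Type) (Omega : set (set X)) (E : porderZmodType)
    (mu : set X -> ext E) : Prop :=
  [/\ forall A, Omega A -> ext_fin 0 <= mu A,
      mu set0 = ext_fin 0 &
      forall A : nat -> set X,
        (forall n, Omega (A n)) -> trivIset setT A ->
        Omega (\bigcup_n A n) ->
        isLub (range (fun N => \sum_(n < N.+1) mu (A n))) (mu (\bigcup_n A n))].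

(* Main.v *)
Require Import Defs.
From mathcomp Require Import all_boot all_order all_algebra.
From mathcomp Require Import all_classical all_reals all_analysis.

Set Implicit Arguments.
Unset Strict Implicit.
Unset Printing Implicit Defensive.

Import Order.TTheory GRing.Theory Num.Theory.

Local Open Scope classical_set_scope.
Local Open Scope ring_scope.

(** Write [G k] for the tail union of the [Delta n] with [k <= n]; these sets
decrease to the limit superior. Infinite values cannot be subtracted and two
elements of [E] need not be comparable, so instead of passing to limits both
parts exploit a supremum that is finite: if [s] in [E] is the least upper
bound of [u] and [u N + h <= s] for every [N], then already [s <= s - h], so
[h <= 0] ([isLub_gap_le0]).

For (1), let [s] be the supremum of the partial sums [S k] of the
[mu (Delta n)]. Countable subadditivity bounds [mu (G k)] by the tail of the
series, which gives [S k + mu (G k) <= s] ([measure_tail_le]). Monotonicity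
then gives [S k + mu Gamma <= s] for all [k], so [mu Gamma] is a finite
positive gap, hence zero.

For (2), the layers [G k `\` G k.+1] partition [G 0 `\` Gamma], so
the finite value [y] of this set is the supremum of the partial sums [u N] of
their measures. The remainder is explicit: [u N + mu (G N.+1 `\` Gamma) = y].
If [mu Gamma = g] is finite, then [x <= mu (G N.+1)] says that
[x - g <= mu (G N.+1 `\` Gamma)]. So [u N + (x - g) <= y] for all [N], and
[x <= g]. This is [measure_bigcap_ge], a form of continuity from above that
uses of the tail unions only that they decrease. *)

(** * Order and addition in the extended space *)

Section ordered_vector.
Context {R : numDomainType} {E : orderedVectType R}.
Implicit Types (x y z : E) (a b c : ext E).

Lemma lev_add2rE z x y : (x + z <= y + z) = (x <= y).
Proof.
apply/idP/idP => [/(lev_add2r (- z))|]; last exact: lev_add2r.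
by rewrite !addrK.
Qed.

Lemma add_extE x y : ext_fin x + ext_fin y = ext_fin (x + y).
Proof. by []. Qed.

Lemma le_extE x y : (ext_fin x <= ext_fin y) = (x <= y).
Proof. by []. Qed.

Lemma le_ext_fin a y : a <= ext_fin y -> exists x, a = ext_fin x.
Proof. by case: a => [x|//] _; exists x. Qed.

Lemma le_ext_add2r c a b : a <= b -> a + c <= b + c.
Proof. by case: a b c => [x|] [y|] [z|] //; exact: lev_add2r. Qed.

Lemma le_ext_add2l c a b : a <= b -> c + a <= c + b.
Proof. by rewrite ![c + _]addrC; exact: le_ext_add2r. Qed.

Lemma le_ext_add a b c d : a <= b -> c <= d -> a + c <= b + d.
Proof.
by move=> ab cd; exact: le_trans (le_ext_add2r c ab) (le_ext_add2l b cd).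
Qed.

Lemma le_ext_addr a b : ext_fin 0 <= b -> a <= a + b.
Proof. by move=> /(le_ext_add2l a); rewrite addr0. Qed.

Lemma le_ext_addl a b : ext_fin 0 <= b -> a <= b + a.
Proof. by rewrite addrC; exact: le_ext_addr. Qed.

Lemma le_ext_sum (u v : nat -> ext E) n :
  (forall i, u i <= v i) -> \sum_(i < n) u i <= \sum_(i < n) v i.
Proof.
move=> uv; elim: n => [|n IHn]; first by rewrite !big_ord0.
by rewrite !big_ord_recr; exact: le_ext_add.
Qed.

Lemma le_ext_subr a x y :
  (a + ext_fin x <= ext_fin y) = (a <= ext_fin (y - x)).
Proof.
by case: a => [z|//]; rewrite add_extE !le_extE -{1}(subrK x y) lev_add2rE.
Qed.

Lemma ge_ext_subr a x y :
  (ext_fin y <= a + ext_fin x) = (ext_fin (y - x) <= a).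
Proof.
by case: a => [z|//]; rewrite add_extE !le_extE -{1}(subrK x y) lev_add2rE.
Qed.

(** If [h] fits between every [u N] and the finite supremum [s], then [s - h] is
an upper bound too. This replaces limit arguments in what follows. *)
Lemma isLub_gap_le0 (u : nat -> ext E) s h :
  isLub (range u) (ext_fin s) ->
  (forall N, u N + ext_fin h <= ext_fin s) -> h <= 0.
Proof.
move=> [_ lub] gap.
rewrite -(lev_add2rE (s - h)) add0r addrC subrK -le_extE.
by apply: lub => _ [N _ <-]; rewrite -le_ext_subr.
Qed.

End ordered_vector.

(** * Decreasing sequences of sets *)

Section decreasing.
Variables (X : Type) (G : nat -> set X).
Hypothesis decG : forall i j, (i <= j)%N -> G j `<=` G i.

Lemma setD_bigcap_layers :
  G 0%N `\` \bigcap_k G k = \bigcup_k (G k `\` G k.+1).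
Proof.
apply/seteqP; split=> x.
  move=> [G0x nGx]; apply: contrapT => nlayer; apply: nGx => k _.
  (* A point lying in no layer never leaves the sequence. *)
  elim: k => [//|k Gkx]; apply: contrapT => nGSk.
  by apply: nlayer; exists k.
move=> [k _ [Gkx nGSk]]; split; first exact: (decG (leq0n k)).
by move=> /(_ k.+1 I).
Qed.

Lemma trivIset_layers : trivIset setT (fun k => G k `\` G k.+1).
Proof.
have disj i j : (i < j)%N ->
    (G i `\` G i.+1) `&` (G j `\` G j.+1) = set0.
  move=> ij; rewrite -subset0 => x [[_ nGSi] [Gj _]].
  by apply: nGSi; exact: (decG ij).
apply/trivIsetP => i j _ _; rewrite neq_ltn => /orP[|] ij; first exact: disj.
by rewrite setIC; exact: disj.
Qed.

End decreasing.

(** * Measures with values in the extended positive cone *)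

Section algebra.
Variables (X : Type) (Omega : set (set X)).
Hypothesis algO : set_algebra Omega.

Lemma algebraU A B : Omega A -> Omega B -> Omega (A `|` B).
Proof. by case: algO => _ _; apply. Qed.

Lemma algebraD A B : Omega A -> Omega B -> Omega (A `\` B).
Proof.
case: algO => _ OC OU OA OB.
by rewrite setDE -[A]setCK -setCU; apply/OC/OU => //; exact: OC.
Qed.

Lemma algebra0 : Omega set0.
Proof. by case: algO => -[A OA] _ _; rewrite -(setDv A); exact: algebraD. Qed.

Lemma algebra_seqDU A n : (forall i, Omega (A i)) -> Omega (seqDU A n).
Proof.
move=> OA; apply: algebraD => //.
by elim/big_ind: _ => //; [exact: algebra0|exact: algebraU].
Qed.

End algebra.

Section measure.
Context {R : numDomainType} {E : orderedVectType R}.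
Variables (X : Type) (Omega : set (set X)) (mu : set X -> ext E).
Hypotheses (algO : set_algebra Omega) (muO : ext_measure Omega mu).

Let mu_ge0 A : Omega A -> ext_fin 0 <= mu A.
Proof. by case: muO => mu_ge0 _ _; exact: mu_ge0. Qed.

(** The sequence [A, B, set0, set0, ...] has constant partial sums from its
second term on, so its supremum is attained; positivity makes the first partial
sum smaller. *)
Lemma measureU A B : Omega A -> Omega B -> A `&` B = set0 ->
  mu (A `|` B) = mu A + mu B.
Proof.
move=> OA OB AB0; case: muO => _ mu0 mu_sigma.
have OAB n : Omega (bigcup2 A B n).
  by case: n => [|[|n]] //; exact: algebra0 algO.
have := mu_sigma _ OAB.
rewrite -trivIset_bigcup2 bigcup2E.
move=> /(_ AB0 (algebraU algO OA OB)) [ub lub].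
have sum2 n : \sum_(i < n.+2) mu (bigcup2 A B i) = mu A + mu B.
  by rewrite !big_ord_recl big1 ?addr0.
apply/le_anti/andP; split; last by apply: ub; exists 1%N.
apply: lub => _ [[|n] _ <-]; last by rewrite sum2.
by rewrite big_ord1 /=; exact/le_ext_addr/mu_ge0.
Qed.

Lemma measureD A B : Omega A -> Omega B -> B `<=` A ->
  mu A = mu (A `\` B) + mu B.
Proof.
move=> OA OB BA; rewrite -measureU //; first by rewrite setUC setDUK.
- exact: algebraD.
- by rewrite setDKI.
Qed.

Lemma le_measure A B : Omega A -> Omega B -> A `<=` B -> mu A <= mu B.
Proof.
move=> OA OB AB; rewrite (measureD OB OA AB).
by apply: le_ext_addl; apply: mu_ge0; exact: algebraD.
Qed.

(** Countable subadditivity, phrased with upper bounds so that no supremum of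
the partial sums has to be named. *)
Lemma measure_bigcup_le (A : nat -> set X) b :
  (forall n, Omega (A n)) -> Omega (\bigcup_n A n) ->
  (forall N, \sum_(n < N.+1) mu (A n) <= b) ->
  mu (\bigcup_n A n) <= b.
Proof.
move=> OA OUA sum_le; case: muO => _ _ mu_sigma.
have ODU n := algebra_seqDU algO n OA.
move: OUA; rewrite seqDU_bigcup_eq => OUA.
have [_ lub] := mu_sigma _ ODU (@trivIset_seqDU _ A) OUA.
apply: lub => _ [N _ <-]; apply: le_trans (sum_le N).
apply: (@le_ext_sum _ _ (mu \o seqDU A) (mu \o A)) => i /=.
by apply: le_measure => //; exact: subset_seqDU.
Qed.

(** The tail union weighs at most the tail of the series, with the initial
partial sum added instead of being subtracted. *)
Lemma measure_tail_le (A : nat -> set X) s k :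
  (forall n, Omega (A n)) ->
  Omega (\bigcup_(n in [set n | (k.+1 <= n)%N]) A n) ->
  (forall N, \sum_(n < N.+1) mu (A n) <= ext_fin s) ->
  \sum_(n < k.+1) mu (A n) + mu (\bigcup_(n in [set n | (k.+1 <= n)%N]) A n)
    <= ext_fin s.
Proof.
move=> OA; rewrite -bigcup_addn => OUA sum_le.
have [r Sk] := le_ext_fin (sum_le k).
rewrite Sk addrC le_ext_subr; apply: measure_bigcup_le => // N.
rewrite -le_ext_subr -Sk addrC.
have := sum_le (k.+1 + N)%N; rewrite -addnS.
by rewrite (@big_split_ord _ _ _ k.+1 N.+1).
Qed.

Section continuity.
Variable G : nat -> set X.
Hypotheses (decG : forall i j, (i <= j)%N -> G j `<=` G i)
  (OG : forall k, Omega (G k)) (OI : Omega (\bigcap_k G k)).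

Let bigcap_sub k : \bigcap_i G i `<=` G k.
Proof. exact: bigcap_inf. Qed.

(** The remainder of the layer series is again the measure of a set, so it can be
estimated without subtracting in the extended space. *)
Lemma measure_layers_rest N :
  \sum_(k < N) mu (G k `\` G k.+1) + mu (G N `\` \bigcap_k G k) =
  mu (G 0%N `\` \bigcap_k G k).
Proof.
elim: N => [|N IHN]; first by rewrite big_ord0 add0r.
rewrite -IHN big_ord_recr -addrA; congr (_ + _).
rewrite -measureU; try exact: algebraD.
- congr (mu _); apply/seteqP; split=> x.
    move=> [[Gx nGSx]|[GSx nIx]]; last by split=> //; exact: (decG (leqnSn N)).
    by split=> // /(@bigcap_sub N.+1).
  by move=> [Gx nIx]; have [GSx|nGSx] := pselect (G N.+1 x); [right|left].
- by rewrite -subset0 => x [[_ nGSx] [GSx _]].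
Qed.

(** The lower half of continuity from above. Only the part of [G 0] outside the
intersection has to have finite measure. *)
Lemma measure_bigcap_ge x y :
  mu (G 0%N `\` \bigcap_k G k) = ext_fin y ->
  (forall k, ext_fin x <= mu (G k)) -> ext_fin x <= mu (\bigcap_k G k).
Proof.
move=> muy xG; case muI : (mu (\bigcap_k G k)) => [g|//].
have xg_le k : ext_fin (x - g) <= mu (G k `\` \bigcap_i G i).
  by rewrite -ge_ext_subr -muI -measureD.
have lub : isLub (range (fun N => \sum_(k < N.+1) mu (G k `\` G k.+1)))
    (ext_fin y).
  case: muO => _ _ mu_sigma; rewrite -muy setD_bigcap_layers //.
  apply: mu_sigma; [by move=> n; exact: algebraD|exact: trivIset_layers|].
  by rewrite -setD_bigcap_layers //; exact: algebraD.
have : x - g <= 0.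
  apply: (isLub_gap_le0 lub) => N.
  by rewrite -muy -(measure_layers_rest N.+1); exact/le_ext_add2l/xg_le.
by rewrite -(lev_add2rE g) subrK add0r.
Qed.

End continuity.

End measure.

Theorem lemma4p7 (R : realType) (X : Type) (Omega : set (set X))
    (E : orderedVectType R) (mu : set X -> ext E) (Delta : nat -> set X)
    (Gamma_ := fun k : nat => \bigcup_(n in [set n | (k <= n)%N]) Delta n)
    (Gamma := \bigcap_k Gamma_ k) :
  set_algebra Omega ->
  sigma_monotone_complete E ->
  ext_measure Omega mu ->
  (forall n, Omega (Delta n)) ->
  (forall k, Omega (Gamma_ k)) ->
  Omega Gamma ->
  ((exists s : E,
      isLub (range (fun N => \sum_(n < N.+1) mu (Delta n))) (ext_fin s)) ->
    mu Gamma = ext_fin 0) /\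
  ((exists y : E, mu ((\bigcup_n Delta n) `\` Gamma) = ext_fin y) ->
    forall x : E, (forall n, ext_fin x <= mu (Delta n)) ->
      ext_fin x <= mu Gamma).
Proof.
move=> algO _ muO OD OG OI.
have [mu_ge0 _ _] := muO.
split=> [[s lub]|[y muy] x xD].
- have sum_le N : \sum_(n < N.+1) mu (Delta n) <= ext_fin s.
    by case: lub => + _; apply; exists N.
  have gap k : \sum_(n < k.+1) mu (Delta n) + mu Gamma <= ext_fin s.
    apply: le_trans (measure_tail_le algO muO OD (OG k.+1) sum_le).
    apply/le_ext_add2l/(le_measure algO muO OI (OG k.+1)).
    exact: bigcap_inf.
  have [g muI] : exists g, mu Gamma = ext_fin g.
    apply: (@le_ext_fin _ _ _ s); apply: le_trans (gap 0%N).
    by rewrite big_ord1; exact/le_ext_addl/mu_ge0.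
  rewrite muI; congr ext_fin; apply/le_anti/andP; split.
    by apply: (isLub_gap_le0 lub) => N; rewrite -muI.
  by rewrite -le_extE -muI; exact: mu_ge0.
- have Gamma0 : Gamma_ 0%N = \bigcup_n Delta n.
    by rewrite /Gamma_ -bigcup_addn.
  apply: (measure_bigcap_ge algO muO _ OG OI (y := y)).
  + by move=> i j ij; apply: bigcup_subset => n /=; exact: leq_trans.
  + by rewrite Gamma0.
  + move=> k; apply: le_trans (xD k) _; apply: (le_measure algO muO) => //.
    by move=> z Dz; exists k => /=.
Qed.
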